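(* Let $K$ be a field of characteristic zero, let $n\geq 1$, and let $d$ be a simple Shamsuddin derivation of the polynomial ring $R=K[X;Y_1,\dots,Y_n]$ in $n+1$ variables. Then the isotropy group $\mathrm{Aut}(R)_d$ of $d$ is trivial, i.e. $\mathrm{Aut}(R)_d=\{\mathrm{id}\}$.
   Context: Derivations are $K$-derivations and $\mathrm{Aut}_K(R)$ is the group of $K$-algebra automorphisms of $R$. A derivation $d$ of a commutative $K$-algebra $R$ is simple if $R$ has no proper non-zero ideal $I$ with $d(I)\subseteq I$. A Shamsuddin derivation of $K[X;Y_1,\dots,Y_n]$ is a derivation of the form $d=\partial_X+\sum_{i=1}^{n}(a_iY_i+b_i)\,\partial_{Y_i}$ with $a_i,b_i\in K[X]$ for every $i=1,\dots,n$. The isotropy group of a derivation $d$ of $R$ is $\mathrm{Aut}(R)_d=\{\rho\in\mathrm{Aut}_K(R)\mid \rho d\rho^{-1}=d\}$. *)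

(* Defs.v *)
From HB Require Import structures.
From mathcomp Require Import all_boot all_order all_algebra.
From mathcomp Require Import mpoly.
Set Implicit Arguments.
Unset Strict Implicit.
Unset Printing Implicit Defensive.
Import GRing.Theory.
Local Open Scope ring_scope.

Definition is_derivation (K : fieldType) (A : comAlgType K) (d : A -> A) : Prop :=
  linear d /\ (forall p q : A, d (p * q) = d p * q + p * d q).

(* Closure under opposites follows from closure under multiplication by -1. *)
Definition is_ideal (A : comNzRingType) (I : A -> Prop) : Prop :=
  [/\ I 0, forall p q, I p -> I q -> I (p + q) & forall r p, I p -> I (r * p)].

Definition simple_derivation
    (K : fieldType) (A : comAlgType K) (d : A -> A) : Prop :=
  is_derivation d /\
  ~ (exists I : A -> Prop,
       [/\ is_ideal I,
           exists p, ~ I p,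
           exists2 p, I p & p <> 0
         & forall p, I p -> I (d p)]).

(* K[X; Y_1, ..., Y_n] is {mpoly K[n.+1]}: X is the variable of index ord0 and
   Y_1, ..., Y_n are those of index lift ord0 i, for i : 'I_n. *)
Definition varX (K : fieldType) (n : nat) : {mpoly K[n.+1]} := 'X_ord0.

Definition varY (K : fieldType) (n : nat) (i : 'I_n) : {mpoly K[n.+1]} :=
  'X_(lift ord0 i).

(* horner_alg (varX K n) embeds K[X] = {poly K} into K[X; Y_1, ..., Y_n]. *)
Definition shamsuddin_fun (K : fieldType) (n : nat) (a b : 'I_n -> {poly K})
    (p : {mpoly K[n.+1]}) : {mpoly K[n.+1]} :=
  mderiv ord0 p +
  \sum_(i < n) (horner_alg (varX K n) (a i) * varY K i
                + horner_alg (varX K n) (b i)) * mderiv (lift ord0 i) p.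

Definition is_shamsuddin (K : fieldType) (n : nat)
    (d : {mpoly K[n.+1]} -> {mpoly K[n.+1]}) : Prop :=
  is_derivation d /\ (exists a b : 'I_n -> {poly K}, d =1 shamsuddin_fun a b).

(* A K-algebra automorphism is an lrmorphism with a two-sided inverse; the
   inverse function is then automatically a K-algebra morphism. *)
Definition in_isotropy (K : fieldType) (A : comAlgType K) (d : A -> A)
    (rho : {lrmorphism A -> A}) : Prop :=
  exists rhoV : A -> A,
    [/\ cancel rho rhoV, cancel rhoV rho & rho \o d \o rhoV =1 d].

Lemma shamsuddin_fun_derivation (K : fieldType) (n : nat)
    (a b : 'I_n -> {poly K}) :
  is_derivation (shamsuddin_fun a b).
Proof.
split=> [c p q|p q]; rewrite /shamsuddin_fun.
  rewrite linearP scalerDr -!addrA; congr (_ + _).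
  rewrite addrCA; congr (_ + _); rewrite scaler_sumr -big_split /=.
  by apply: eq_bigr => i _; rewrite linearP mulrDr -scalerAr.
rewrite mderivM mulrDl mulrDr -!addrA; congr (_ + _).
rewrite addrCA; congr (_ + _); rewrite mulr_suml mulr_sumr -big_split /=.
by apply: eq_bigr => i _; rewrite mderivM mulrDr mulrA [p * (_ * _)]mulrCA.
Qed.

(* Main.v *)
Require Import Defs.
From HB Require Import structures.
From mathcomp Require Import all_boot all_order all_algebra.
From mathcomp Require Import mpoly.
Import GRing.Theory.
Local Open Scope ring_scope.

(** Let D = d/dX + \sum_i (a_i Y_i + b_i) d/dY_i be simple and let rho commute
    with D.  If D f = g f with f nonzero, then the ideal (f) is D-stable, so f
    is a unit, i.e. a constant of K, and therefore g = 0
    ([simple_darboux_const]).  Everything else is obtained by exhibiting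
    suitable eigenvectors f.

    No a_i is constant: if it were, h' = a_i h + b_i would have a solution h in
    K[X] in characteristic zero, and Y_i - h would be a nonconstant
    eigenvector ([simple_shamsuddin_nonconst]).

    Next, D (rho X - X) = 1 - 1 = 0, so rho X = X + c for some c in K
    ([isotropy_shift]).  Put y = rho Y_i; then D y = a_i(X+c) y + b_i(X+c).
    Since [D, d/dY_j] = - a_j d/dY_j, every partial derivative d y / d Y_j is
    an eigenvector with eigenvalue a_i(X+c) - a_j.  One of these derivatives is
    nonzero, for otherwise y, and with it Y_i, would lie in K[X]; hence
    a_j = a_i(X+c) for some j ([isotropy_shift_coefficient]).  So the finite
    family (a_i) is stable under the translation X |-> X + c, and if c were
    nonzero some a_i would be periodic, hence constant: thus c = 0
    ([isotropy_shift0]).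

    Finally, with rho X = X, both rho Y_i and Y_i solve D y = a_i y + b_i, so
    their difference is an eigenvector with eigenvalue a_i != 0, which forces
    it to vanish ([isotropy_varY]). *)

Local Notation inX n p := (horner_alg (varX _ n) p).

(** * Univariate polynomials in characteristic zero *)

(** For a = 0 this is termwise integration.  Otherwise h = - b/a + h1 solves the
    equation for b as soon as h1 solves it for b'/a, which is of smaller
    degree. *)
Lemma poly_primitive_linear {K : fieldType} (hK : [pchar K] =i pred0)
    (a : K) (b : {poly K}) : exists h : {poly K}, h^`() = a *: h + b.
Proof.
have [->|a0] := eqVneq a 0.
  exists (\poly_(i < (size b).+1) (b`_i.-1 / i%:R)); apply/polyP => i.
  rewrite scale0r add0r coef_deriv coef_poly ltnS /=.
  case: ltnP => [_|hi]; last by rewrite mul0rn nth_default.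
  by rewrite -[LHS]mulr_natr divfK // (proj1 (pcharf0P K)).
have [m hm] := ubnP (size b); elim: m b hm => // m IHm b hm.
have [->|b0] := eqVneq b 0; first by exists 0; rewrite deriv0 scaler0 addr0.
have [] := IHm (a^-1 *: b^`()).
  by apply: leq_ltn_trans (size_scale_leq _ _) (leq_trans (lt_size_deriv b0) _).
move=> h hh; exists (h - a^-1 *: b).
by rewrite derivB derivZ hh scalerBr scalerA mulfV // scale1r addrK subrK.
Qed.

(** All the multiples k c are roots of p - p(0), and they are pairwise distinct
    in characteristic zero. *)
Lemma poly_periodic_const {K : fieldType} (hK : [pchar K] =i pred0)
    (p : {poly K}) (c : K) :
  c != 0 -> p \Po ('X + c%:P) = p -> (size p <= 1)%N.
Proof.
move=> c0 hp; pose q := p - p.[0]%:P.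
have hroot k : p.[k%:R * c] = p.[0].
  elim: k => [|k IHk]; first by rewrite mul0r.
  by rewrite -IHk -[in RHS]hp horner_comp !hornerE -natr1 mulrDl mul1r.
have [q0|q0] := eqVneq q 0.
  by rewrite -[p](subrK p.[0]%:P) -/q q0 add0r size_polyC leq_b1.
suff: (size [seq (k%:R * c)%R | k <- iota 0 (size q)] < size q)%N.
  by rewrite size_map size_iota ltnn.
apply: max_poly_roots => //.
  by apply/allP => _ /mapP[k _ ->]; rewrite rootE !hornerE hroot subrr.
rewrite map_inj_uniq ?iota_uniq // => k l /(mulIf c0)/eqP hkl.
wlog le_kl : k l hkl / (k <= l)%N.
  move=> W; case/orP: (leq_total k l) => hle; first exact: W.
  by apply/esym/W; rewrite // eq_sym.
move: hkl; rewrite eq_sym -subr_eq0 -natrB // (proj1 (pcharf0P K) hK).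
by rewrite subn_eq0 => le_lk; apply/eqP; rewrite eqn_leq le_kl.
Qed.

(** * Simple derivations *)

Lemma simple_derivation_ext {K : fieldType} {A : comAlgType K} (d d' : A -> A) :
  d =1 d' -> simple_derivation d -> simple_derivation d'.
Proof.
move=> e [[dlin dM] dS]; split.
  by split=> [c p q|p q]; rewrite -!e ?dlin ?dM.
case=> I [hI h1 h2 hd]; apply: dS; exists I; split=> // p /hd.
by rewrite e.
Qed.

Lemma derivationB {K : fieldType} {A : comAlgType K} (d : A -> A) (p q : A) :
  is_derivation d -> d (p - q) = d p - d q.
Proof. by case=> dlin _; rewrite addrC -scaleN1r dlin scaleN1r addrC. Qed.

(** The ideal generated by f is stable under d, so simplicity makes f a unit;
    the units of a polynomial ring over a field are the nonzero constants,
    which d annihilates. *)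
Lemma simple_darboux_const {K : fieldType} {n : nat}
    (d : {mpoly K[n]} -> {mpoly K[n]}) (f g : {mpoly K[n]}) :
  simple_derivation d -> f != 0 -> d f = g * f ->
  g = 0 /\ exists k : K, f = k%:MP.
Proof.
move=> [[dlin dM] dS] f0 df.
pose dL := GRing.isLinear.Build _ _ _ _ d dlin.
pose D : {linear _ -> _} := HB.pack d dL.
have d1 : d 1 = 0.
  by apply: (addrI (d 1)); rewrite addr0 -[in RHS](mulr1 1) dM mulr1 mul1r.
have dC (k : K) : d k%:MP = 0.
  by rewrite -[k%:MP]mulr1 mul_mpolyC -[d]/(D : _ -> _) linearZ /= d1 scaler0.
have [/andP[/eqP fC _]|nunit] := boolP (mpoly_unit f).
  split; last by exists f@_0.
  by move/esym/eqP: df; rewrite fC dC -fC mulf_eq0 (negPf f0) orbF => /eqP.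
case: dS; exists (fun p => exists q, p = q * f); split.
- split=> [|_ _ [p ->] [q ->]|r _ [p ->]]; first by exists 0; rewrite mul0r.
    by exists (p + q); rewrite mulrDl.
  by exists (r * p); rewrite mulrA.
- exists 1; case=> q /esym hq.
  by move/negP: nunit; apply; apply: mpoly_intro_unit hq.
- by exists f; [exists 1; rewrite mul1r|apply/eqP].
- by move=> _ [q ->]; exists (d q + q * g); rewrite dM df mulrA mulrDl.
Qed.

(** * The subring K[X] of K[X; Y_1, ..., Y_n] *)

Lemma mderiv1 {K : fieldType} {n : nat} (i : 'I_n) :
  (1 : {mpoly K[n]})^`M(i) = 0.
Proof. by rewrite -mpolyC1 mderivC. Qed.

Lemma mderiv_var {K : fieldType} {n : nat} (i j : 'I_n) :
  ('X_i : {mpoly K[n]})^`M(j) = (i == j)%:R.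
Proof.
rewrite mderivX mnm1E; case: eqP => [->|_]; last by rewrite scale0r.
by rewrite -[X in (X - _)%MM]add0m addmK mpolyX0 scale1r.
Qed.

Lemma mderivX_horner_alg {K : fieldType} {n : nat} (p : {poly K}) :
  (inX n p)^`M(ord0) = inX n p^`().
Proof.
elim/poly_ind: p => [|p c IHp]; first by rewrite deriv0 rmorph0 mderiv0.
rewrite derivD derivC addr0 derivM derivX mulr1 !rmorphD !rmorphM /=.
rewrite horner_algC horner_algX mderivD mderivM IHp mderivZ.
by rewrite [(varX K n)^`M(_)]mderiv_var eqxx mderiv1 scaler0 addr0 mulr1.
Qed.

Lemma mderivY_horner_alg {K : fieldType} {n : nat} (p : {poly K}) (j : 'I_n) :
  (inX n p)^`M(lift ord0 j) = 0.
Proof.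
elim/poly_ind: p => [|p c IHp]; first by rewrite rmorph0 mderiv0.
rewrite rmorphD rmorphM /= horner_algC horner_algX mderivD mderivM IHp mderivZ.
by rewrite [(varX K n)^`M(_)]mderiv_var mderiv1 scaler0 mul0r mulr0 !addr0.
Qed.

Lemma mderiv_varY {K : fieldType} {n : nat} (i j : 'I_n) :
  (varY K i)^`M(lift ord0 j) = (i == j)%:R.
Proof. by rewrite mderiv_var (inj_eq lift_inj). Qed.

(** The morphism to K[X] sending every variable to X is a retraction. *)
Lemma horner_alg_varX_inj {K : fieldType} {n : nat} :
  injective (horner_alg (varX K n)).
Proof.
pose r := mmap polyC (fun i : 'I_n.+1 => 'X : {poly K}).
have rK p : r (inX n p) = p.
  elim/poly_ind: p => [|p c IHp]; first by rewrite /r !rmorph0.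
  rewrite rmorphD rmorphM /= horner_algC horner_algX /r rmorphD rmorphM /=.
  by rewrite -/r IHp /r mmapX mmap1U mmapZ rmorph1 mulr1.
exact: can_inj rK.
Qed.

(** Characteristic zero enters because d/dY_j multiplies the coefficient of a
    monomial by its Y_j-exponent, which has to be invertible when nonzero. *)
Lemma mpoly_no_varY {K : fieldType} (hK : [pchar K] =i pred0) {n : nat}
    (p : {mpoly K[n.+1]}) :
  (forall j : 'I_n, p^`M(lift ord0 j) = 0) -> exists h, p = inX n h.
Proof.
move=> hp; exists (\sum_(m <- msupp p) p@_m *: 'X^(m ord0)).
rewrite rmorph_sum [LHS]mpolyE; apply: eq_big_seq => m hm.
rewrite -mul_polyC rmorphM rmorphXn /= horner_algC horner_algX mulr_algl.
congr (_ *: _).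
rewrite mpolyXE_id big_ord_recl big1 ?mulr1 // => j _.
suff -> : m (lift ord0 j) = 0%N by rewrite expr0.
apply/eqP; rewrite -leqn0 leqNgt; apply/negP => mj.
have /eqP := congr1 (mcoeff (m - U_(lift ord0 j))) (hp j).
rewrite mcoeff_deriv mcoeff0 submK ?lep1mP -?lt0n // -mulr_natr mulf_eq0.
by rewrite (proj1 (pcharf0P K)) // orbF mcoeff_eq0 hm.
Qed.

(** * Shamsuddin derivations *)

Lemma shamsuddin_horner_alg {K : fieldType} {n : nat} (a b : 'I_n -> {poly K})
    (p : {poly K}) :
  shamsuddin_fun a b (inX n p) = inX n p^`().
Proof.
rewrite /shamsuddin_fun mderivX_horner_alg big1 ?addr0 // => i _.
by rewrite mderivY_horner_alg mulr0.
Qed.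

Lemma shamsuddin_varY {K : fieldType} {n : nat} (a b : 'I_n -> {poly K})
    (i : 'I_n) :
  shamsuddin_fun a b (varY K i) =
    inX n (a i) * varY K i + inX n (b i).
Proof.
rewrite /shamsuddin_fun [X in X + _]mderiv_var add0r.
rewrite (bigD1 i) //= mderiv_varY eqxx mulr1 big1 ?addr0 // => j ji.
by rewrite mderiv_varY eq_sym (negPf ji) mulr0.
Qed.

(** This is the commutation relation [d/dY_j, D] = a_j d/dY_j: among the
    coefficients of D only a_j Y_j + b_j depends on Y_j. *)
Lemma mderiv_shamsuddin {K : fieldType} {n : nat} (a b : 'I_n -> {poly K})
    (p : {mpoly K[n.+1]}) (j : 'I_n) :
  (shamsuddin_fun a b p)^`M(lift ord0 j) =
    shamsuddin_fun a b p^`M(lift ord0 j) + inX n (a j) * p^`M(lift ord0 j).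
Proof.
rewrite /shamsuddin_fun mderivD mderiv_comm -addrA; congr (_ + _).
rewrite raddf_sum /= (eq_bigr (fun i =>
  (inX n (a i) * varY K i + inX n (b i))
     * p^`M(lift ord0 j)^`M(lift ord0 i)
  + (i == j)%:R * (inX n (a i) * p^`M(lift ord0 i)))); last first.
  move=> i _; rewrite mderivM mderivD mderivM !mderivY_horner_alg mderiv_varY.
  rewrite mul0r add0r addr0 addrC mderiv_comm; congr (_ + _).
  by rewrite mulrA [_ * _%:R]mulrC.
rewrite big_split /=; congr (_ + _).
rewrite (bigD1 j) //= eqxx mul1r big1 ?addr0 // => i /negPf ->.
by rewrite mul0r.
Qed.

(** A solution h would make Y_i - h a nonconstant eigenvector of D, with
    eigenvalue a_i. *)
Lemma simple_shamsuddin_no_polynomial_solution {K : fieldType} {n : nat}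
    (a b : 'I_n -> {poly K}) (i : 'I_n) (h : {poly K}) :
  simple_derivation (shamsuddin_fun a b) -> h^`() <> a i * h + b i.
Proof.
move=> hs hh.
have [hder _] := hs.
pose f := varY K i - inX n h.
have f1 : f^`M(lift ord0 i) = 1.
  by rewrite mderivB mderiv_varY eqxx mderivY_horner_alg subr0.
have f0 : f != 0.
  by apply/eqP => f0; move/eqP: f1; rewrite f0 mderiv0 eq_sym oner_eq0.
have Df : shamsuddin_fun a b f = inX n (a i) * f.
  rewrite /f derivationB // shamsuddin_varY shamsuddin_horner_alg hh.
  by rewrite rmorphD rmorphM /= mulrBr opprD addrACA subrr addr0.
have [_ [k fk]] := simple_darboux_const _ _ _ hs f0 Df.
by move/eqP: f1; rewrite fk mderivC eq_sym oner_eq0.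
Qed.

Lemma simple_shamsuddin_nonconst {K : fieldType} (hK : [pchar K] =i pred0)
    {n : nat} (a b : 'I_n -> {poly K}) (i : 'I_n) :
  simple_derivation (shamsuddin_fun a b) -> (1 < size (a i))%N.
Proof.
move=> hs; rewrite ltnNge; apply/negP => /size1_polyC ai.
have [h hh] := poly_primitive_linear hK (a i)`_0 (b i).
apply: (simple_shamsuddin_no_polynomial_solution a b i h hs).
by rewrite hh [in RHS]ai mul_polyC.
Qed.

(** * The isotropy group *)

Lemma lrmorphism_horner_alg_shift {K : fieldType} {n : nat}
    (rho : {lrmorphism {mpoly K[n.+1]} -> {mpoly K[n.+1]}}) (c : K)
    (p : {poly K}) :
  rho (varX K n) = varX K n + c%:MP ->
  rho (inX n p) = inX n (p \Po ('X + c%:P)).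
Proof.
move=> hX; elim/poly_ind: p => [|p k IHp].
  by rewrite comp_poly0 !rmorph0.
rewrite comp_polyD comp_polyM comp_polyX comp_polyC !rmorphD !rmorphM /=.
rewrite !rmorphD /= !horner_algX !horner_algC IHp hX rmorph_alg.
by rewrite -[c%:MP]mulr1 mul_mpolyC.
Qed.

Lemma lrmorphism_mpoly_id {K : fieldType} {n : nat}
    (rho : {lrmorphism {mpoly K[n.+1]} -> {mpoly K[n.+1]}}) :
  rho (varX K n) = varX K n -> (forall i, rho (varY K i) = varY K i) ->
  rho =1 id.
Proof.
move=> hX hY p; rewrite [in LHS](mpolyE p) [RHS]mpolyE rmorph_sum /=.
apply: eq_bigr => m _; rewrite linearZ mpolyXE_id rmorph_prod; congr (_ *: _).
apply: eq_bigr => i _; rewrite rmorphXn; congr (_ ^+ _).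
by case: (unliftP ord0 i) => [j ->|->]; [exact: hY|exact: hX].
Qed.

Lemma isotropy_shift {K : fieldType} {n : nat} (a b : 'I_n -> {poly K})
    (rho : {lrmorphism {mpoly K[n.+1]} -> {mpoly K[n.+1]}}) :
  simple_derivation (shamsuddin_fun a b) ->
  (forall p, rho (shamsuddin_fun a b p) = shamsuddin_fun a b (rho p)) ->
  exists c : K, rho (varX K n) = varX K n + c%:MP.
Proof.
move=> hs hrho; have [hder _] := hs.
have DX : shamsuddin_fun a b (varX K n) = 1.
  by rewrite -(horner_algX (varX K n)) shamsuddin_horner_alg derivX rmorph1.
set f := rho (varX K n) - varX K n.
have Df : shamsuddin_fun a b f = 0 * f.
  by rewrite /f derivationB // -hrho DX rmorph1 subrr mul0r.
have rhoX : rho (varX K n) = varX K n + f by rewrite addrC subrK.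
have [f0|f0] := eqVneq f 0; first by exists 0; rewrite rhoX f0.
have [_ [k fk]] := simple_darboux_const _ _ _ hs f0 Df.
by exists k; rewrite rhoX fk.
Qed.

(** The eigenvector here is a nonzero partial derivative of rho Y_i with respect
    to some Y_j: its eigenvalue a_i(X+c) - a_j has to vanish. *)
Lemma isotropy_shift_coefficient {K : fieldType}
    (hK : [pchar K] =i pred0) {n : nat} (a b : 'I_n -> {poly K}) (c : K)
    (rho : {lrmorphism {mpoly K[n.+1]} -> {mpoly K[n.+1]}}) (i : 'I_n) :
  simple_derivation (shamsuddin_fun a b) ->
  (forall p, rho (shamsuddin_fun a b p) = shamsuddin_fun a b (rho p)) ->
  injective rho -> rho (varX K n) = varX K n + c%:MP ->
  exists j, a j = a i \Po ('X + c%:P).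
Proof.
move=> hs hrho rho_inj hX; set y := rho (varY K i).
have [j yj|y0] := pickP (fun j : 'I_n => y^`M(lift ord0 j) != 0).
  exists j.
  have Dy : shamsuddin_fun a b y^`M(lift ord0 j) =
      (inX n (a i \Po ('X + c%:P)) - inX n (a j)) * y^`M(lift ord0 j).
    rewrite mulrBl; apply: (canRL (addrK _)).
    rewrite -mderiv_shamsuddin -hrho shamsuddin_varY rmorphD rmorphM /=.
    rewrite !(lrmorphism_horner_alg_shift _ _ _ hX) mderivD mderivM.
    by rewrite !mderivY_horner_alg mul0r add0r addr0.
  have [/eqP] := simple_darboux_const _ _ _ hs yj Dy.
  by rewrite subr_eq0 => /eqP/horner_alg_varX_inj.
(* Otherwise y lies in K[X], hence Y_i too: rho maps K[X] onto itself. *)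
have [|h yh] := mpoly_no_varY hK y.
  by move=> j; apply/eqP/negPn; rewrite y0.
have /rho_inj hY : rho (varY K i) = rho (inX n (h \Po ('X - c%:P))).
  rewrite (lrmorphism_horner_alg_shift _ _ _ hX) -comp_polyA comp_polyB.
  by rewrite comp_polyX comp_polyC addrK comp_polyXr.
have /eqP := congr1 (mderiv (lift ord0 i)) hY.
by rewrite mderiv_varY eqxx mderivY_horner_alg oner_eq0.
Qed.

(** Iterating i |-> j from [isotropy_shift_coefficient] yields n+1 indices
    in a set of size n; a repetition at steps k < l says that some a_j has
    period (l - k) c. *)
Lemma isotropy_shift0 {K : fieldType} (hK : [pchar K] =i pred0) {n : nat}
    (hn : (1 <= n)%N) (a b : 'I_n -> {poly K}) (c : K)
    (rho : {lrmorphism {mpoly K[n.+1]} -> {mpoly K[n.+1]}}) :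
  simple_derivation (shamsuddin_fun a b) ->
  (forall p, rho (shamsuddin_fun a b p) = shamsuddin_fun a b (rho p)) ->
  injective rho -> rho (varX K n) = varX K n + c%:MP -> c = 0.
Proof.
move=> hs hrho rho_inj hX; apply/eqP/negPn/negP => c0.
have next i : exists j, a j == a i \Po ('X + c%:P).
  have [j hj] :=
    isotropy_shift_coefficient hK a b c rho i hs hrho rho_inj hX.
  by exists j; apply/eqP.
pose s i := xchoose (next i).
have iter_s k i : a (iter k s i) = a i \Po ('X + (k%:R * c)%:P).
  elim: k => [|k IHk]; first by rewrite mul0r addr0 comp_polyXr.
  rewrite iterS (eqP (xchooseP (next _))) IHk -comp_polyA comp_polyD comp_polyX.
  rewrite comp_polyC -addrA -polyCD -natr1 mulrDl mul1r.
  by rewrite [c + _]addrC.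
pose i0 := Ordinal hn.
have /injectivePn[k [l kl hkl]] :
    ~~ injectiveb (fun k : 'I_n.+1 => iter k s i0).
  by apply/injectiveP => /leq_card; rewrite !card_ord ltnn.
wlog lt_kl : k l kl hkl / (k < l)%N.
  move=> W; have [/W|/W|/val_inj] := ltngtP k l; first exact.
    by apply=> //; rewrite eq_sym.
  by move/eqP; rewrite (negPf kl).
have per : a (iter k s i0) \Po ('X + ((l - k)%:R * c)%:P) = a (iter k s i0).
  by rewrite -iter_s -iterD subnK ?(ltnW lt_kl) // hkl.
have := simple_shamsuddin_nonconst hK a b (iter k s i0) hs.
rewrite ltnNge (poly_periodic_const hK _ _ _ per) //.
by rewrite mulf_neq0 // (proj1 (pcharf0P K)) // -lt0n subn_gt0.
Qed.

(** The eigenvector here is rho Y_i - Y_i, with eigenvalue a_i. *)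
Lemma isotropy_varY {K : fieldType} (hK : [pchar K] =i pred0) {n : nat}
    (a b : 'I_n -> {poly K})
    (rho : {lrmorphism {mpoly K[n.+1]} -> {mpoly K[n.+1]}}) (i : 'I_n) :
  simple_derivation (shamsuddin_fun a b) ->
  (forall p, rho (shamsuddin_fun a b p) = shamsuddin_fun a b (rho p)) ->
  rho (varX K n) = varX K n -> rho (varY K i) = varY K i.
Proof.
move=> hs hrho hX; have [hder _] := hs.
have fix_inX p : rho (inX n p) = inX n p.
  by rewrite (lrmorphism_horner_alg_shift rho 0) ?addr0 ?comp_polyXr.
apply/eqP; rewrite -subr_eq0; set z := _ - _; apply/negPn/negP => z0.
have Dz : shamsuddin_fun a b z = inX n (a i) * z.
  rewrite /z derivationB // -hrho shamsuddin_varY rmorphD rmorphM /=.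
  by rewrite !fix_inX opprD addrACA subrr addr0 mulrBr.
have [ai _] := simple_darboux_const _ _ _ hs z0 Dz.
have := simple_shamsuddin_nonconst hK a b i hs.
suff -> : a i = 0 by rewrite size_poly0.
by apply: (@horner_alg_varX_inj K n); rewrite ai rmorph0.
Qed.

Theorem theorem3p2 (K : fieldType) (hK : [pchar K] =i pred0)
    (n : nat) (hn : (1 <= n)%N)
    (d : {mpoly K[n.+1]} -> {mpoly K[n.+1]})
    (hsham : is_shamsuddin d) (hsimple : simple_derivation d)
    (rho : {lrmorphism {mpoly K[n.+1]} -> {mpoly K[n.+1]}}) :
  in_isotropy d rho <-> rho =1 id.
Proof.
split=> [[rhoV [rhoK _ hd]]|hid]; last first.
  by exists id; split=> // p; rewrite ?hid //= hid.
have [_ [a [b dE]]] := hsham.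
have hs := simple_derivation_ext _ _ dE hsimple.
have hrho p : rho (shamsuddin_fun a b p) = shamsuddin_fun a b (rho p).
  by rewrite -!dE -[RHS]hd /= rhoK.
have [c hX] := isotropy_shift a b rho hs hrho.
have c0 := isotropy_shift0 hK hn a b c rho hs hrho (can_inj rhoK) hX.
have hX0 : rho (varX K n) = varX K n by rewrite hX c0 raddf0 addr0.
by apply: (lrmorphism_mpoly_id rho hX0) => i; apply: isotropy_varY hs hrho hX0.
Qed.
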